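(* Consider a projective plane of order $q$, and let $\{l_j: 1\le j\le \frac{q^2+q}{2}\}$ be a family of distinct lines. For each $j$, let $p_j$ be a point on $l_j$ and let $l_j'=l_j\setminus\{p_j\}$. Then there exists a line $m$ such that $$\#\Bigl(m\cap\bigcup\{l_j' : l_j\ne m\}\Bigr)>\frac{q+1}{2}.$$
   Context: A projective plane of order $q$ (with $q\ge 2$ an integer) is a finite projective plane in which every line contains exactly $q+1$ points and every point lies on exactly $q+1$ lines; it has $q^2+q+1$ points and $q^2+q+1$ lines. Lines are regarded as sets of points. The plane is not assumed to be Desarguesian. *)

(* Defs.v *)
From mathcomp Require Import all_boot.

Set Implicit Arguments.
Unset Strict Implicit.
Unset Printing Implicit Defensive.

(* The points of the plane are the elements of the finite type T; a line is
   the set of points on it, and L is the set of lines. *)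
Record projective_plane (T : finType) (L : {set {set T}}) : Prop :=
  ProjectivePlane {
    join_line : forall x y : T, x != y ->
      exists! l : {set T}, [/\ l \in L, x \in l & y \in l];
    meet_point : forall l m : {set T}, l \in L -> m \in L -> l != m ->
      exists! x : T, x \in l /\ x \in m;
    (* four points, no three of which are collinear *)
    quadrangle : exists Q : {set T},
      #|Q| = 4 /\ (forall l : {set T}, l \in L -> #|Q :&: l| <= 2)
  }.

Record projective_plane_of_order (q : nat) (T : finType) (L : {set {set T}})
    : Prop := ProjectivePlaneOfOrder {
    plane_of_order : projective_plane L;
    card_line : forall l : {set T}, l \in L -> #|l| = q + 1;
    card_pencil : forall x : T, #|[set l in L | x \in l]| = q + 1
  }.

(* Main.v *)
(* Let a(x) be the number of sets l_j' containing x.  Double counting gives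
   sum_x a(x) = n q and sum_x a(x)^2 <= n q + n (n - 1), where n is the number
   of lines in the family.  A point x with a(x) >= 2 contributes to all the
   q + 1 lines through it, and one with a(x) = 1 to at least q of them.
   Since (a - k) (a - k - 1) >= 0 for integers, this bounds the sum over all
   lines m of #(m /\ U_m), U_m being the union of the l_j' with l_j <> m, from
   below by a combination of the two moments.  If every m satisfied
   #(m /\ U_m) <= (q + 1) / 2, then k = q (for q >= 4) or k = 2 (for q <= 3)
   would give a contradiction; for q = 2 one needs to round (q + 1) / 2
   down. *)
Require Import Defs.
From mathcomp Require Import all_boot all_order all_algebra zify.

Import Order.TTheory GRing.Theory Num.Theory.

Set Implicit Arguments.
Unset Strict Implicit.
Unset Printing Implicit Defensive.

Lemma card_meet_lines (T : finType) (L : {set {set T}}) (l m : {set T}) :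
  projective_plane L -> l \in L -> m \in L -> l != m -> #|l :&: m| = 1.
Proof.
move=> hL lL mL lm; have [x [[xl xm] ux]] := meet_point hL lL mL lm.
apply/eqP/cards1P; exists x; apply/setP=> y; rewrite !inE.
apply/andP/eqP => [[yl ym]|->]; last by [].
by rewrite (ux y).
Qed.

Lemma card_incidence (I T : finType) (P : pred T) (F : I -> {set T}) :
  \sum_(x | P x) #|[set i | x \in F i]| = \sum_i #|F i :&: [set x | P x]|.
Proof.
under eq_bigr do rewrite -sum1dep_card big_mkcond.
rewrite exchange_big; apply: eq_bigr => i _.
by rewrite -sum1_card -big_mkcondr; apply: eq_bigl => x; rewrite !inE andbC.
Qed.

(** Both sides count the triples [(x, i, j)] with [x] in [F i] and in [F j]. *)
Lemma sum_sqr_incidence (I T : finType) (F : I -> {set T}) :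
  \sum_x #|[set i | x \in F i]| ^ 2 = \sum_i \sum_j #|F i :&: F j|.
Proof.
transitivity (\sum_i \sum_(x in F i) #|[set j | x \in F j]|).
  rewrite (exchange_big_dep xpredT) //=; apply: eq_bigr => x _.
  by rewrite sum_nat_cond_const expnS expn1; congr (_ * _).
apply: eq_bigr => i _; rewrite card_incidence; apply: eq_bigr => j _.
by rewrite setIC; apply: eq_card => x; rewrite !inE.
Qed.

(** Each line other than [m] meets [m] in a point, and each of the [q + 1] points of [m] lies on [q]
    further lines. *)
Lemma card_lines_le (q : nat) (T : finType) (L : {set {set T}}) (m : {set T}) :
  projective_plane_of_order q L -> m \in L -> #|L| <= q ^ 2 + q + 1.
Proof.
move=> hL mL; rewrite (cardsD1 m) mL addnC leq_add2r -sum1_card.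
apply: (@leq_trans (\sum_(l in L :\ m) #|m :&: l|)).
  apply: leq_sum => l; rewrite !inE => /andP[lm lL].
  by rewrite (card_meet_lines (plane_of_order hL) mL lL) // eq_sym.
under eq_bigr do rewrite -sum1_card.
rewrite (exchange_big_dep (mem m)) /=; last first.
  by move=> l x _; rewrite inE => /andP[].
apply: (@leq_trans (\sum_(x in m) q)).
  apply: leq_sum => x xm; rewrite sum1dep_card.
  have := card_pencil hL x.
  rewrite (cardsD1 m [set l in L | x \in l]) !inE mL xm addnC.
  move=> /eqP; rewrite eqn_add2r => /eqP <-.
  apply: subset_leq_card; apply/subsetP => l.
  by rewrite !inE => /andP[/andP[-> ->] /andP[_ ->]].
by rewrite sum_nat_const (card_line hL mL); nia.
Qed.

(* The chord of the parabola through k and k + 1 lies below it at integers. *)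
Lemma chord_le_sqr (k a : nat) : (2 * k + 1) * a <= k * (k + 1) + a ^ 2.
Proof.
have [/subnKC <-|/ltnW /subnKC <-] := leqP k a.
  have : a - k <= (a - k) * (a - k) by case: (a - k) => // d; rewrite leq_pmulr.
  by move: (a - k) => d hd; rewrite -mulnn; lia.
by rewrite -mulnn; lia.
Qed.

(** The case [k = q] of the final estimate, with [n] lines in the family and [h] bounding every
    [#(m /\ U_m)]. *)
Lemma moment_contradiction (q n h : nat) :
  3 < q -> 2 * n = q * (q + 1) -> 0 < n -> 2 * h <= q + 1 ->
  ~~ ((q + 1) * ((2 * q + 1) * (n * q)) <=
      q * (q + 1) * ((q ^ 2 + q + 1) * h) + (q + 1) * (n * (q + n.-1))).
Proof.
move=> q_gt3 n2 n_gt0 h2; apply/negP.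
rewrite -[q * (q + 1) * _]mulnA [q * ((q + 1) * _)]mulnCA -mulnDr.
rewrite leq_pmul2l; last by rewrite addn1.
(* As [q * (q + 1)] is [2 * n], the bound on [h] becomes a multiple of [n], so that [n] cancels
   below. *)
have hN : (q ^ 2 + q + 1) * q * (2 * h) <= 2 * (n * (q ^ 2 + q + 1)).
  have -> : 2 * (n * (q ^ 2 + q + 1)) = (q ^ 2 + q + 1) * q * (q + 1).
    by rewrite -mulnA -n2; lia.
  by rewrite leq_mul2l h2 orbT.
have {}hN : q * ((q ^ 2 + q + 1) * h) <= n * (q ^ 2 + q + 1).
  by rewrite -(leq_pmul2l (isT : 0 < 2)); apply: leq_trans hN; lia.
move=> bound.
have : n * ((2 * q + 1) * q) <= n * (q ^ 2 + q + 1 + (q + n.-1)).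
  rewrite mulnDr; apply: leq_trans (leq_add hN (leqnn _)).
  by apply: leq_trans bound; lia.
rewrite leq_pmul2l // => sqr_bound.
(* What remains is [q ^ 2 <= q + n], that is, [q <= 3]. *)
have : 4 * q <= q * q by rewrite leq_mul2r q_gt3 orbT.
by move: sqr_bound n2; rewrite -mulnn; lia.
Qed.

Section PuncturedLines.

Variables (q : nat) (T I : finType) (L : {set {set T}}).
Hypotheses (hq : 2 <= q) (hL : projective_plane_of_order q L).
Variables (l : I -> {set T}) (p : I -> T).
Hypotheses (hl : forall j, l j \in L) (l_inj : injective l).
Hypothesis hp : forall j, p j \in l j.

Local Notation punctured j := (l j :\ p j).
Local Notation multiplicity x := #|[set j | x \in punctured j]|.
Local Notation others m := (\bigcup_(j | l j != m) punctured j).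
Local Notation covered_lines x :=
  [set m : {set T} | (m \in L) && (x \in m :&: others m)].

Lemma card_punctured j : #|punctured j| = q.
Proof.
have := card_line hL (hl j); rewrite (cardsD1 (p j) (l j)) hp addnC.
by move=> /eqP; rewrite eqn_add2r => /eqP.
Qed.

Lemma sum_multiplicity : \sum_x multiplicity x = #|I| * q.
Proof.
rewrite card_incidence -sum_nat_const; apply: eq_bigr => j _.
by rewrite -(card_punctured j); apply: eq_card => x; rewrite !inE andbT.
Qed.

(** Diagonal pairs contribute [q] each. Two distinct lines share one point, which the puncturing may
    remove, so every other pair contributes at most 1. *)
Lemma sum_sqr_multiplicity :
  \sum_x multiplicity x ^ 2 <= #|I| * (q + #|I|.-1).
Proof.
rewrite sum_sqr_incidence -sum_nat_const; apply: leq_sum => i _.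
rewrite (bigD1 i) //= setIid card_punctured leq_add2l.
rewrite -(cardC1 i) -sum1_card; apply: leq_sum => j ji.
have lij : l i != l j by rewrite (inj_eq l_inj) eq_sym.
rewrite -(card_meet_lines (plane_of_order hL) (hl i) (hl j) lij).
by apply: subset_leq_card; apply: setISS; apply: subsetDl.
Qed.

(** If [x] lies on the punctured [l j], then [l j] itself covers [x] on each of the [q] other lines
    through [x]. *)
Lemma card_covered_lines_ge x :
  0 < multiplicity x -> q <= #|covered_lines x|.
Proof.
case/card_gt0P => j; rewrite inE => xj.
have xl : x \in l j by case/setD1P: xj.
have := card_pencil hL x.
rewrite (cardsD1 (l j) [set m in L | x \in m]) !inE hl xl addnC.
move=> /eqP; rewrite eqn_add2r => /eqP <-.
apply: subset_leq_card; apply/subsetP => m; rewrite !inE => /and3P[mj -> ->] /=.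
by apply/bigcupP; exists j => //; rewrite eq_sym.
Qed.

(** A line through [x] differs from at least one of two distinct family lines whose punctured sets
    contain [x]. *)
Lemma card_covered_lines x :
  1 < multiplicity x -> #|covered_lines x| = q + 1.
Proof.
case/card_gt1P => i [j []]; rewrite !inE => xi xj ij.
rewrite -(card_pencil hL x); apply: eq_card => m; rewrite !inE.
case: (m \in L) => //=; case: (x \in m) => //=; apply/bigcupP.
have [lim|lim] := eqVneq (l i) m; last by exists i; rewrite // !inE.
by exists j; rewrite ?inE // -lim (inj_eq l_inj) eq_sym.
Qed.

(** For multiplicity at least 2 this is the chord inequality times [q + 1]. For multiplicity 1,
    where one line may be missing, the slack in [k] compensates. *)
Lemma weight_bound (k : nat) x : 2 <= k ->
  (q + 1) * ((2 * k + 1) * multiplicity x) <=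
  k * (k + 1) * #|covered_lines x| + (q + 1) * multiplicity x ^ 2.
Proof.
move=> hk; have := @card_covered_lines_ge x; have := @card_covered_lines x.
move: (multiplicity x) (#|covered_lines x|) => [|[|a]] w hw2 hw1.
- by rewrite !muln0.
- have {hw1 hw2} qw := hw1 isT.
  (* The need is [2 * (q + 1) <= (k + 1) * w], and [2 * (q + 1) <= 3 * q] since [q >= 2]. *)
  have h3 : 3 * q <= (k + 1) * w by apply: leq_mul; lia.
  have -> : (q + 1) * ((2 * k + 1) * 1) = k * (2 * (q + 1)) + (q + 1) by lia.
  by rewrite exp1n muln1 leq_add2r -mulnA leq_mul2l; lia.
- rewrite hw2 // [k * _ * _]mulnC -mulnDr leq_mul2l; apply/orP; right.
  exact: chord_le_sqr.
Qed.

Lemma sum_weight_bound (k : nat) : 2 <= k ->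
  (q + 1) * ((2 * k + 1) * (#|I| * q)) <=
  k * (k + 1) * (\sum_(m in L) #|m :&: others m|)
    + (q + 1) * (#|I| * (q + #|I|.-1)).
Proof.
move=> hk.
(* Count the pairs of a line [m] and a point [x] of [m] covered by the others in two ways. *)
have -> : \sum_(m in L) #|m :&: others m| = \sum_x #|covered_lines x|.
  under eq_bigr do rewrite -sum1_card.
  rewrite (exchange_big_dep xpredT) //=; apply: eq_bigr => x _.
  by rewrite sum1dep_card.
apply: leq_trans (leq_add (leqnn _) (leq_mul (leqnn _) sum_sqr_multiplicity)).
rewrite -sum_multiplicity !big_distrr -big_split /=.
by apply: leq_sum => x _; apply: weight_bound.
Qed.

End PuncturedLines.

Theorem lemma2p4 (q : nat) (hq : 2 <= q) (T : finType) (L : {set {set T}})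
    (hL : projective_plane_of_order q L)
    (l : 'I_((q ^ 2 + q) %/ 2) -> {set T})
    (hl : forall j, l j \in L) (l_inj : injective l)
    (p : 'I_((q ^ 2 + q) %/ 2) -> T) (hp : forall j, p j \in l j) :
  exists2 m : {set T}, m \in L &
    ((q + 1)%:R / 2%:R < #|m :&: \bigcup_(j | l j != m) (l j :\ p j)|%:R :> rat)%R.
Proof.
have [/existsP[m /andP[mL hm]]|/existsPn small] :=
  boolP [exists m : {set T}, (m \in L) &&
    (q + 1 < 2 * #|m :&: \bigcup_(j | l j != m) (l j :\ p j)|)].
  exists m => //; rewrite ltr_pdivrMr ?ltr0n // -natrM ltr_nat.
  by rewrite mulnC.
have n2 : 2 * ((q ^ 2 + q) %/ 2) = q * (q + 1).
  have -> : q ^ 2 + q = q * (q + 1) by nia.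
  by rewrite mulnC divnK // dvdn2 oddM oddD /=; case: (odd q).
have n_gt0 : 0 < (q ^ 2 + q) %/ 2 by nia.
have cardL := card_lines_le hL (hl (Ordinal n_gt0)).
have le_half : \sum_(m in L) #|m :&: \bigcup_(j | l j != m) (l j :\ p j)|
    <= (q ^ 2 + q + 1) * ((q + 1) %/ 2).
  apply: leq_trans (leq_mul cardL (leqnn _)).
  rewrite -sum_nat_const; apply: leq_sum => m mL.
  by rewrite leq_divRL // mulnC leqNgt; have := small m; rewrite mL.
have bound k : 2 <= k -> (q + 1) * ((2 * k + 1) * ((q ^ 2 + q) %/ 2 * q)) <=
    k * (k + 1) * ((q ^ 2 + q + 1) * ((q + 1) %/ 2))
      + (q + 1) * ((q ^ 2 + q) %/ 2 * (q + ((q ^ 2 + q) %/ 2).-1)).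
  move=> hk; have := sum_weight_bound hq hL hl l_inj hp hk.
  rewrite card_ord => /leq_trans; apply.
  by rewrite leq_add2r leq_mul2l le_half orbT.
exfalso.
have [q_small|q_ge4] := ltnP q 4.
  (* With [k = 2] the bound reads [90 <= 78] for [q = 2] and [360 <= 348] for [q = 3]. *)
  have /orP[/eqP q2|/eqP q3] : (q == 2) || (q == 3) by lia.
  - by have := bound 2 isT; rewrite q2.
  - by have := bound 2 isT; rewrite q3.
have := bound q hq; apply/negP; apply: moment_contradiction => //.
by rewrite mulnC leq_divM.
Qed.
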